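(* Let $R$ be a commutative ring with $1$, let $n\geq 1$, let $(\mathcal C,\mathbb E,\mathfrak s)$ be a small $R$-linear extriangulated category and let $\mathcal X=\operatorname{add}\mathcal X$ be an $n$-rigid subcategory of $\mathcal C$. (1) If $\mathcal X$ is strongly covariantly finite, then $$\mathcal X=\operatorname{Tr}^{+}_{n}(\mathcal X)\cap\bigcap_{i=1}^{n}\mathcal X^{\perp_i}.$$ (2) If $\mathcal X$ is strongly contravariantly finite, then $$\mathcal X=\operatorname{Tr}^{-}_{n}(\mathcal X)\cap\bigcap_{i=1}^{n}{}^{\perp_i}\mathcal X.$$
   Context: Conventions: all categories are additive; subcategories are full and closed under isomorphisms; $\mathcal X=\operatorname{add}\mathcal X$ means $\mathcal X$ is closed under finite direct sums and direct summands; a category is small if its objects and morphisms form sets. Extriangulated categories $(\mathcal C,\mathbb E,\mathfrak s)$ are in the sense of Nakaoka--Palu; an $\mathbb E$-triangle is written $A\to B\to C\dashrightarrow$ and realizes an element of $\mathbb E(C,A)$. $R$-linear means that $\mathcal C$ is $R$-linear and $\mathbb E$ is an $R$-bilinear bifunctor $\mathcal C^{\mathrm{op}}\times\mathcal C\to R\text{-Mod}$. Positive higher extensions (Gorsky--Nakaoka--Palu): $\mathbb E^1=\mathbb E$ and $\mathbb E^i=\mathbb E^{\diamond i}$ is the $i$-fold tensor product of the $\mathcal C$-bimodule $\mathbb E$ over $\mathcal C$, i.e. $\mathbb E^{i}(C,A)=\int^{M\in\mathcal C}\mathbb E^{i-1}(C,M)\otimes_R\mathbb E(M,A)$. It is known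 that each $\mathbb E$-triangle induces long exact sequences $\mathcal C(X,A)\to\mathcal C(X,B)\to\mathcal C(X,C)\to\mathbb E(X,A)\to\mathbb E(X,B)\to\mathbb E(X,C)\to\mathbb E^2(X,A)\to\cdots$ and the contravariant analogue. $\mathcal X$ is $n$-rigid if $\mathbb E^i(X,X')=0$ for all $X,X'\in\mathcal X$ and $1\le i\le n$. For $i\ge1$, ${}^{\perp_i}\mathcal X=\{A\mid \mathbb E^i(A,X)=0\ \forall X\in\mathcal X\}$ and $\mathcal X^{\perp_i}=\{A\mid \mathbb E^i(X,A)=0\ \forall X\in\mathcal X\}$. A left $\mathcal X$-approximation of $A$ is a morphism $x_A:A\to X_A$ with $X_A\in\mathcal X$ through which every morphism from $A$ to an object of $\mathcal X$ factors; right approximations are dual. $\mathcal X$ is strongly covariantly finite if each $A\in\mathcal C$ admits an $\mathbb E$-triangle $A\xrightarrow{x_A}X_A\to A^+\dashrightarrow$ with $x_A$ a left $\mathcal X$-approximation; strongly contravariantly finite is dual: each $A$ admits an $\mathbb E$-triangle $A^-\to X^A\to A\dashrightarrow$ whose second morphism is a right $\mathcal X$-approximation. $\mathcal C/[\mathcal X]$ is the ideal quotient by the morphisms factoring through objects of $\mathcal X$, with quotient functor $\pi_{\mathcal X}$. If $\mathcal X$ is strongly covariantly finite, the canonical suspension $\Sigma_{\mathcal X}:\mathcal C/[\mathcal X]\to\mathcal C/[\mathcal X]$ is given by $\Sigma_{\mathcal X}(\pi_{\mathcal X}A)=\pi_{\mathcal X}(A^+)$ for chosen left approximation $\mathbb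 E$-triangles; on $f:A\to B$ one completes $f$ to a morphism $(f,g,h)$ of the chosen $\mathbb E$-triangles and sets $\Sigma_{\mathcal X}(\pi_{\mathcal X}f)=\pi_{\mathcal X}h$ (well defined, and independent of choices up to natural isomorphism). If $\mathcal X$ is strongly contravariantly finite, the canonical loop $\Omega_{\mathcal X}$ is defined dually, with $\Omega_{\mathcal X}(\pi_{\mathcal X}A)=\pi_{\mathcal X}(A^-)$. Put $\operatorname{Tr}^{+}_{n}(\mathcal X)=\{A\in\mathcal C\mid\Sigma_{\mathcal X}^n(\pi_{\mathcal X}A)\cong0\}$ and $\operatorname{Tr}^{-}_{n}(\mathcal X)=\{A\in\mathcal C\mid\Omega_{\mathcal X}^n(\pi_{\mathcal X}A)\cong0\}$ whenever the respective functor is defined. *)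

(* Defs.v *)
From HB Require Import structures.
From mathcomp Require Import all_boot all_algebra.
From mathcomp Require Import boolp classical_sets.

Set Implicit Arguments.
Unset Strict Implicit.
Unset Printing Implicit Defensive.

Import GRing.Theory.
Local Open Scope ring_scope.
Local Open Scope quotient_scope.
#[local] Obligation Tactic := idtac.

Declare Scope cat_scope.
Delimit Scope cat_scope with C.
Local Open Scope cat_scope.

Record linCat (R : comPzRingType) := LinCat {
  Ob :> Type;
  Hom : Ob -> Ob -> lmodType R;
  idm : forall a, Hom a a;
  comp : forall a b c, Hom b c -> Hom a b -> Hom a c;
  comp1m : forall a b (f : Hom a b), comp (idm b) f = f;
  compm1 : forall a b (f : Hom a b), comp f (idm a) = f;
  compA : forall a b c d (h : Hom c d) (g : Hom b c) (f : Hom a b),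
    comp h (comp g f) = comp (comp h g) f;
  comp_linl : forall a b c (f : Hom a b) (r : R) (g g' : Hom b c),
    comp (r *: g + g') f = r *: comp g f + comp g' f;
  comp_linr : forall a b c (g : Hom b c) (r : R) (f f' : Hom a b),
    comp g (r *: f + f') = r *: comp g f + comp g f' }.

Arguments Hom {R l} a b : rename.
Arguments idm {R l} a : rename.
Notation "g ∘ f" := (comp g f) (at level 40, left associativity) : cat_scope.

Section LinCat.
Variables (R : comPzRingType) (C : linCat R).

Definition is_iso (a b : C) (f : Hom a b) : Prop :=
  exists g : Hom b a, g ∘ f = idm a /\ f ∘ g = idm b.

Definition isomorphic (a b : C) : Prop := exists f : Hom a b, is_iso f.

Definition zero_object (z : C) : Prop :=
  (forall (a : C) (f g : Hom a z), f = g) /\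
  (forall (a : C) (f g : Hom z a), f = g).

Definition iso_zero (a : C) : Prop :=
  exists z : C, zero_object z /\ isomorphic a z.

Record biprod (a b p : C) := Biprod {
  in1 : Hom a p;
  in2 : Hom b p;
  pr1 : Hom p a;
  pr2 : Hom p b;
  pr1in1 : pr1 ∘ in1 = idm a;
  pr2in2 : pr2 ∘ in2 = idm b;
  pr1in2 : pr1 ∘ in2 = 0;
  pr2in1 : pr2 ∘ in1 = 0;
  biprod_id : in1 ∘ pr1 + in2 ∘ pr2 = idm p }.

Definition biprod_map (a b p a' b' p' : C) (s : biprod a b p)
    (s' : biprod a' b' p') (f : Hom a a') (g : Hom b b') : Hom p p' :=
  in1 s' ∘ f ∘ pr1 s + in2 s' ∘ g ∘ pr2 s.

Lemma compDl a b c (f : Hom a b) (g g' : Hom b c) :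
  (g + g') ∘ f = g ∘ f + g' ∘ f :> @Hom R C a c.
Proof. by have := comp_linl f 1 g g'; rewrite !scale1r. Qed.

Lemma compDr a b c (g : Hom b c) (f f' : Hom a b) :
  g ∘ (f + f') = g ∘ f + g ∘ f' :> @Hom R C a c.
Proof. by have := comp_linr g 1 f f'; rewrite !scale1r. Qed.

Lemma comp0l a b c (f : Hom a b) : 0 ∘ f = 0 :> @Hom R C a c.
Proof. by apply: (addrI (0 ∘ f)); rewrite -compDl !addr0. Qed.

Lemma comp0r a b c (g : Hom b c) : g ∘ 0 = 0 :> @Hom R C a c.
Proof. by apply: (addrI (g ∘ 0)); rewrite -compDr !addr0. Qed.

Lemma compZl a b c (f : Hom a b) r (g : Hom b c) :
  (r *: g) ∘ f = r *: (g ∘ f) :> @Hom R C a c.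
Proof. by have := comp_linl f r g 0; rewrite comp0l !addr0. Qed.

Lemma compZr a b c (g : Hom b c) r (f : Hom a b) :
  g ∘ (r *: f) = r *: (g ∘ f) :> @Hom R C a c.
Proof. by have := comp_linr g r f 0; rewrite comp0r !addr0. Qed.

Lemma compNl a b c (f : Hom a b) (g : Hom b c) :
  (- g) ∘ f = - (g ∘ f) :> @Hom R C a c.
Proof. by rewrite -scaleN1r compZl scaleN1r. Qed.

Lemma compNr a b c (g : Hom b c) (f : Hom a b) :
  g ∘ (- f) = - (g ∘ f) :> @Hom R C a c.
Proof. by rewrite -scaleN1r compZr scaleN1r. Qed.

End LinCat.

Record addCat (R : comPzRingType) := AddCat {
  add_lin :> linCat R;
  has_zero : exists z : add_lin, zero_object z;
  has_biprod : forall a b : add_lin, exists p, inhabited (biprod a b p) }.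

Record functor (R : comPzRingType) (C D : linCat R) := Functor {
  fob :> C -> D;
  fmor : forall a b : C, Hom a b -> Hom (fob a) (fob b);
  fmor_id : forall a, fmor (idm a) = idm (fob a);
  fmor_comp : forall a b c (g : Hom b c) (f : Hom a b),
    fmor (g ∘ f) = fmor g ∘ fmor f }.

Definition id_functor (R : comPzRingType) (C : linCat R) : functor C C :=
  @Functor R C C id (fun _ _ f => f) (fun _ => erefl) (fun _ _ _ _ _ => erefl).

Program Definition comp_functor (R : comPzRingType) (C D E : linCat R)
    (G : functor D E) (F : functor C D) : functor C E :=
  @Functor R C E (fun a => G (F a)) (fun a b f => fmor G (fmor F f)) _ _.
Next Obligation. by move=> * /=; rewrite !fmor_id. Qed.
Next Obligation. by move=> * /=; rewrite !fmor_comp. Qed.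

Definition pow_functor (R : comPzRingType) (C : linCat R) (F : functor C C)
    (n : nat) : functor C C := iter n (comp_functor F) (id_functor C).

(* [F c a] is contravariant in [c] and covariant in [a]; [push f] is
   f_* = F(c, f) and [pull f] is f^* = F(f, a). *)
Record bimod (R : comPzRingType) (C : linCat R) := Bimod {
  bm :> C -> C -> lmodType R;
  push : forall c a a', Hom a a' -> bm c a -> bm c a';
  pull : forall c c' a, Hom c' c -> bm c a -> bm c' a;
  push_id : forall c a (e : bm c a), push (idm a) e = e;
  push_comp : forall c a a' a'' (g : Hom a' a'') (f : Hom a a') (e : bm c a),
    push (g ∘ f) e = push g (push f e);
  pull_id : forall c a (e : bm c a), pull (idm c) e = e;
  pull_comp : forall c c' c'' a (g : Hom c' c) (f : Hom c'' c') (e : bm c a),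
    pull (g ∘ f) e = pull f (pull g e);
  push_pull : forall c c' a a' (f : Hom a a') (g : Hom c' c) (e : bm c a),
    push f (pull g e) = pull g (push f e);
  push_lin : forall c a a' (f : Hom a a') r (e e' : bm c a),
    push f (r *: e + e') = r *: push f e + push f e';
  pull_lin : forall c c' a (g : Hom c' c) r (e e' : bm c a),
    pull g (r *: e + e') = r *: pull g e + pull g e';
  push_linm : forall c a a' r (f f' : Hom a a') (e : bm c a),
    push (r *: f + f') e = r *: push f e + push f' e;
  pull_linm : forall c c' a r (g g' : Hom c' c) (e : bm c a),
    pull (r *: g + g') e = r *: pull g e + pull g' e }.

Section BimodTheory.
Variables (R : comPzRingType) (C : linCat R) (F : bimod C).

Lemma pushD c a a' (f : Hom a a') (e e' : F c a) :
  push f (e + e') = push f e + push f e'.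
Proof. by have := push_lin f 1 e e'; rewrite !scale1r. Qed.

Lemma push0 c a a' (f : Hom a a') : push f (0 : F c a) = 0.
Proof. by apply: (addrI (push f 0)); rewrite -pushD !addr0. Qed.

Lemma pushZ c a a' (f : Hom a a') r (e : F c a) :
  push f (r *: e) = r *: push f e.
Proof. by have := push_lin f r e 0; rewrite push0 !addr0. Qed.

Lemma pullD c c' a (g : Hom c' c) (e e' : F c a) :
  pull g (e + e') = pull g e + pull g e'.
Proof. by have := pull_lin g 1 e e'; rewrite !scale1r. Qed.

Lemma pull0 c c' a (g : Hom c' c) : pull g (0 : F c a) = 0.
Proof. by apply: (addrI (pull g 0)); rewrite -pullD !addr0. Qed.

Lemma pullZ c c' a (g : Hom c' c) r (e : F c a) :
  pull g (r *: e) = r *: pull g e.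
Proof. by have := pull_lin g r e 0; rewrite pull0 !addr0. Qed.

Lemma pushmB c a a' (f f' : Hom a a') (e : F c a) :
  push (f - f') e = push f e - push f' e.
Proof.
have := push_linm (-1) f' f e; rewrite !scaleN1r => H.
by rewrite addrC H addrC.
Qed.

Lemma pullmB c c' a (g g' : Hom c' c) (e : F c a) :
  pull (g - g') e = pull g e - pull g' e.
Proof.
have := pull_linm (-1) g' g e; rewrite !scaleN1r => H.
by rewrite addrC H addrC.
Qed.

End BimodTheory.

(* The coend is presented by generators and relations: a word is a formal sum
   of symbols x (x) y with x in F(c, m) and y in G(m, a), the scalar r acting
   through its action on x.  The quotient of the monoid of words by
   [coend_eq] is a group because of [ce_zero]: -x (x) y is an opposite of
   x (x) y. *)
Section Coend.
Variables (R : comPzRingType) (C : linCat R) (F G : bimod C).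

Definition symb (c a : C) : Type := {m : C & (F c m * G m a)%type}.

Definition tens (c a m : C) (x : F c m) (y : G m a) : symb c a :=
  existT (fun m => (F c m * G m a)%type) m (x, y).

Definition word (c a : C) : Type := {classic (seq (symb c a))}.

Inductive coend_eq (c a : C) : seq (symb c a) -> seq (symb c a) -> Prop :=
| ce_refl s : coend_eq s s
| ce_sym s t : coend_eq s t -> coend_eq t s
| ce_trans s t u : coend_eq s t -> coend_eq t u -> coend_eq s u
| ce_cat s s' t t' :
    coend_eq s s' -> coend_eq t t' -> coend_eq (s ++ t) (s' ++ t')
| ce_comm s t : coend_eq (s ++ t) (t ++ s)
| ce_zero m (y : G m a) : coend_eq [:: tens (0 : F c m) y] [::]
| ce_addl m (x x' : F c m) (y : G m a) :
    coend_eq [:: tens (x + x') y] [:: tens x y; tens x' y]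
| ce_addr m (x : F c m) (y y' : G m a) :
    coend_eq [:: tens x (y + y')] [:: tens x y; tens x y']
| ce_scale m r (x : F c m) (y : G m a) :
    coend_eq [:: tens (r *: x) y] [:: tens x (r *: y)]
| ce_balance m m' (h : Hom m m') (x : F c m) (y : G m' a) :
    coend_eq [:: tens (push h x) y] [:: tens x (pull h y)].

Definition coend_rel (c a : C) : rel (word c a) :=
  fun s t => `[< coend_eq s t >].

Lemma coend_rel_refl c a : reflexive (@coend_rel c a).
Proof. by move=> s; apply/asboolP; exact: ce_refl. Qed.

Lemma coend_rel_sym c a : symmetric (@coend_rel c a).
Proof. by move=> s t; apply/asboolP/asboolP; exact: ce_sym. Qed.

Lemma coend_rel_trans c a : transitive (@coend_rel c a).
Proof.
by move=> t s u /asboolP st /asboolP tu; apply/asboolP; exact: ce_trans st tu.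
Qed.

Canonical coend_equiv (c a : C) : equiv_rel (word c a) :=
  EquivRel (@coend_rel c a) (@coend_rel_refl c a) (@coend_rel_sym c a)
    (@coend_rel_trans c a).

Definition coend_obj (c a : C) : Type := {eq_quot (coend_equiv c a)}.
HB.instance Definition _ c a := Choice.on (coend_obj c a).
HB.instance Definition _ c a := EqQuotient.on (coend_obj c a).

Local Notation wcl s := (\pi_(coend_obj _ _) s).

Lemma coend_piP c a (s t : word c a) :
  \pi_(coend_obj c a) s = \pi_(coend_obj c a) t <-> coend_eq s t.
Proof.
split=> [/eqmodP/asboolP//|st]; by apply/eqmodP/asboolP.
Qed.

Lemma coend_reprP c a (s : word c a) :
  coend_eq (repr (\pi_(coend_obj c a) s)) s.
Proof. by apply/coend_piP; rewrite reprK. Qed.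

Lemma ce_opp c a m (x : F c m) (y : G m a) :
  coend_eq [:: tens (- x) y; tens x y] [::].
Proof.
apply: (ce_trans _ (ce_zero c y)); apply: ce_sym.
by rewrite -[0](addNr x); exact: ce_addl.
Qed.

Definition word_map c a c' a' (phi : forall m, F c m -> F c' m)
    (psi : forall m, G m a -> G m a') (s : word c a) : word c' a' :=
  [seq tens (phi _ (projT2 t).1) (psi _ (projT2 t).2) | t <- (s : seq _)].

Lemma word_map_eq c a c' a' (phi : forall m, F c m -> F c' m)
    (psi : forall m, G m a -> G m a') (s t : word c a) :
  (forall m r (x x' : F c m), phi m (r *: x + x') = r *: phi m x + phi m x') ->
  (forall m r (y y' : G m a), psi m (r *: y + y') = r *: psi m y + psi m y') ->
  (forall m m' (h : Hom m m') x, phi m' (push h x) = push h (phi m x)) ->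
  (forall m m' (h : Hom m m') y, psi m (pull h y) = pull h (psi m' y)) ->
  coend_eq s t -> coend_eq (word_map phi psi s) (word_map phi psi t).
Proof.
move=> phil psil phip psip.
have phiD m x x' : phi m (x + x') = phi m x + phi m x'.
  by have := phil m 1 x x'; rewrite !scale1r.
have phi0 m : phi m 0 = 0.
  by apply: (addrI (phi m 0)); rewrite -phiD !addr0.
have phiZ m r x : phi m (r *: x) = r *: phi m x.
  by have := phil m r x 0; rewrite phi0 !addr0.
have psiD m y y' : psi m (y + y') = psi m y + psi m y'.
  by have := psil m 1 y y'; rewrite !scale1r.
have psi0 m : psi m 0 = 0.
  by apply: (addrI (psi m 0)); rewrite -psiD !addr0.
have psiZ m r y : psi m (r *: y) = r *: psi m y.
  by have := psil m r y 0; rewrite psi0 !addr0.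
elim=> {s t} [s|s t _|s t u _ st _ tu|s s' t t' _ ss _ tt|s t|m y|m x x' y
  |m x y y'|m r x y|m m' h x y].
- exact: ce_refl.
- exact: ce_sym.
- exact: ce_trans st tu.
- by rewrite /word_map !map_cat; exact: ce_cat.
- by rewrite /word_map !map_cat; exact: ce_comm.
- by rewrite /word_map /= phi0; exact: ce_zero.
- by rewrite /word_map /= phiD; exact: ce_addl.
- by rewrite /word_map /= psiD; exact: ce_addr.
- by rewrite /word_map /= phiZ psiZ; exact: ce_scale.
- by rewrite /word_map /= phip psip; exact: ce_balance.
Qed.

Section Module.
Variables c a : C.
Implicit Types u v : coend_obj c a.

Definition word_scale (r : R) : word c a -> word c a :=
  word_map (fun m x => r *: x) (fun m y => y).

Definition coend_zero : coend_obj c a := wcl ([::] : word c a).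
Definition coend_add u v : coend_obj c a :=
  wcl ((repr u ++ repr v : seq _) : word c a).
Definition coend_scale (r : R) u : coend_obj c a := wcl (word_scale r (repr u)).
Definition coend_opp u : coend_obj c a := coend_scale (-1) u.

Lemma word_scale_eq r (s t : word c a) :
  coend_eq s t -> coend_eq (word_scale r s) (word_scale r t).
Proof.
apply: word_map_eq => // [m q x x'|m m' h x]; last by rewrite pushZ.
by rewrite scalerDr !scalerA mulrC.
Qed.

Lemma coend_addE (s t : word c a) :
  coend_add (wcl s) (wcl t) = wcl ((s ++ t : seq _) : word c a).
Proof. by apply/coend_piP/ce_cat; exact: coend_reprP. Qed.

Lemma coend_scaleE r (s : word c a) :
  coend_scale r (wcl s) = wcl (word_scale r s).
Proof. by apply/coend_piP/word_scale_eq; exact: coend_reprP. Qed.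

Lemma coend_addA : associative coend_add.
Proof.
move=> u v w; rewrite -[u]reprK -[v]reprK -[w]reprK.
rewrite [coend_add (wcl (repr v)) _]coend_addE.
by rewrite [coend_add _ (wcl (repr v))]coend_addE !coend_addE catA.
Qed.

Lemma coend_addC : commutative coend_add.
Proof.
move=> u v; rewrite -[u]reprK -[v]reprK !coend_addE.
by apply/coend_piP; exact: ce_comm.
Qed.

Lemma coend_add0 : left_id coend_zero coend_add.
Proof. by move=> u; rewrite -[u]reprK coend_addE. Qed.

Lemma coend_addN : left_inverse coend_zero coend_opp coend_add.
Proof.
move=> u; rewrite -[u]reprK /coend_opp [coend_scale _ _]coend_scaleE coend_addE.
apply/coend_piP; elim: (repr u : seq _) => [|[m [x y]] s IHs] /=.
  exact: ce_refl.
apply: (@ce_trans _ _ _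
  ([:: tens (- x) y; tens x y] ++ (word_scale (-1) s ++ s))); last first.
  by rewrite -[[::]]/([::] ++ [::]); apply: ce_cat => //; exact: ce_opp.
rewrite /= scaleN1r -cat1s -[X in coend_eq _ X]cat1s.
apply: ce_cat; first exact: ce_refl.
rewrite -cat1s -[X in coend_eq _ X]cat1s !catA.
by apply: ce_cat; [exact: ce_comm|exact: ce_refl].
Qed.

HB.instance Definition _ := GRing.isZmodule.Build (coend_obj c a)
  coend_addA coend_addC coend_add0 coend_addN.

Lemma coend_scaleA r q u :
  coend_scale r (coend_scale q u) = coend_scale (r * q) u.
Proof.
rewrite -[u]reprK [coend_scale q _]coend_scaleE !coend_scaleE.
rewrite /word_scale /word_map -map_comp.
by congr (wcl _); apply: eq_map => -[m [x y]] /=; rewrite scalerA.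
Qed.

Lemma coend_scale1 : left_id 1 coend_scale.
Proof.
move=> u; rewrite -[u]reprK coend_scaleE; congr (wcl _).
by rewrite /word_scale /word_map -[RHS]map_id; apply: eq_map
  => -[m [x y]] /=; rewrite scale1r.
Qed.

Lemma coend_scaleDr : right_distributive coend_scale +%R.
Proof.
move=> r u v; rewrite -[u]reprK -[v]reprK.
rewrite -[LHS]/(coend_scale r (coend_add _ _)) coend_addE !coend_scaleE.
by rewrite -[RHS]/(coend_add _ _) coend_addE /word_scale /word_map map_cat.
Qed.

Lemma word_interleave (T : Type) (f g h : T -> symb c a) (s : seq T) :
  (forall t, coend_eq [:: f t] [:: g t; h t]) ->
  coend_eq (map f s) (map g s ++ map h s).
Proof.
move=> fgh; elim: s => [|t s IHs] /=; first exact: ce_refl.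
apply: (@ce_trans _ _ _ ([:: g t; h t] ++ (map g s ++ map h s))).
  by rewrite -cat1s; exact: ce_cat.
rewrite /= -cat1s -[X in coend_eq _ X]cat1s.
apply: ce_cat; first exact: ce_refl.
rewrite -cat1s -[h t :: map h s]cat1s !catA.
by apply: ce_cat; [exact: ce_comm|exact: ce_refl].
Qed.

Lemma coend_scaleDl u : {morph coend_scale^~ u : r q / r + q}.
Proof.
move=> r q; rewrite -[u]reprK !coend_scaleE.
rewrite -[RHS]/(coend_add _ _) coend_addE; apply/coend_piP.
by apply: word_interleave => -[m [x y]] /=; rewrite scalerDl; exact: ce_addl.
Qed.

HB.instance Definition _ := GRing.Zmodule_isLmodule.Build R (coend_obj c a)
  coend_scaleA coend_scale1 coend_scaleDr coend_scaleDl.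

End Module.

Definition coend_push (c a a' : C) (f : Hom a a') (u : coend_obj c a)
    : coend_obj c a' :=
  wcl (word_map (fun m x => x) (fun m y => push f y) (repr u)).

Definition coend_pull (c c' a : C) (g : Hom c' c) (u : coend_obj c a)
    : coend_obj c' a :=
  wcl (word_map (fun m x => pull g x) (fun m y => y) (repr u)).

Lemma coend_pushE c a a' (f : Hom a a') (s : word c a) :
  coend_push f (wcl s) = wcl (word_map (fun m x => x) (fun m y => push f y) s).
Proof.
apply/coend_piP/word_map_eq => // *; last exact: coend_reprP.
  by rewrite push_lin.
by rewrite push_pull.
Qed.

Lemma coend_pullE c c' a (g : Hom c' c) (s : word c a) :
  coend_pull g (wcl s) = wcl (word_map (fun m x => pull g x) (fun m y => y) s).
Proof.
apply/coend_piP/word_map_eq => // *; last exact: coend_reprP.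
  by rewrite pull_lin.
by rewrite push_pull.
Qed.

Lemma coend_linE c a r (s t : word c a) :
  r *: (wcl s : coend_obj c a) + wcl t
  = wcl ((word_scale r s ++ t : seq _) : word c a).
Proof.
by rewrite -[LHS]/(coend_add (coend_scale _ _) _) coend_scaleE coend_addE.
Qed.

Lemma coend_push_id c a (u : coend_obj c a) : coend_push (idm a) u = u.
Proof.
rewrite -[u]reprK coend_pushE; congr (wcl _); rewrite -[RHS]map_id.
by apply: eq_map => -[m [x y]] /=; rewrite push_id.
Qed.

Lemma coend_pull_id c a (u : coend_obj c a) : coend_pull (idm c) u = u.
Proof.
rewrite -[u]reprK coend_pullE; congr (wcl _); rewrite -[RHS]map_id.
by apply: eq_map => -[m [x y]] /=; rewrite pull_id.
Qed.

Lemma coend_push_comp c a a' a'' (g : Hom a' a'') (f : Hom a a')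
  (u : coend_obj c a) : coend_push (g ∘ f) u = coend_push g (coend_push f u).
Proof.
rewrite -[u]reprK [coend_push f (wcl _)]coend_pushE !coend_pushE.
congr (wcl _); rewrite /word_map -map_comp.
by apply: eq_map => -[m [x y]] /=; rewrite push_comp.
Qed.

Lemma coend_pull_comp c c' c'' a (g : Hom c' c) (f : Hom c'' c')
  (u : coend_obj c a) : coend_pull (g ∘ f) u = coend_pull f (coend_pull g u).
Proof.
rewrite -[u]reprK [coend_pull g (wcl _)]coend_pullE !coend_pullE.
congr (wcl _); rewrite /word_map -map_comp.
by apply: eq_map => -[m [x y]] /=; rewrite pull_comp.
Qed.

Lemma coend_push_pull c c' a a' (f : Hom a a') (g : Hom c' c)
  (u : coend_obj c a) :
  coend_push f (coend_pull g u) = coend_pull g (coend_push f u).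
Proof.
rewrite -[u]reprK [coend_pull _ (wcl _)]coend_pullE.
rewrite [coend_push _ (wcl (repr _))]coend_pushE coend_pushE coend_pullE.
congr (wcl _).
by rewrite /word_map -!map_comp.
Qed.

Lemma coend_push_lin c a a' (f : Hom a a') r (u v : coend_obj c a) :
  coend_push f (r *: u + v) = r *: coend_push f u + coend_push f v.
Proof.
rewrite -[u]reprK -[v]reprK coend_linE !coend_pushE coend_linE.
by congr (wcl _); rewrite /word_scale /word_map map_cat -!map_comp.
Qed.

Lemma coend_pull_lin c c' a (g : Hom c' c) r (u v : coend_obj c a) :
  coend_pull g (r *: u + v) = r *: coend_pull g u + coend_pull g v.
Proof.
rewrite -[u]reprK -[v]reprK coend_linE !coend_pullE coend_linE.
congr (wcl _); rewrite /word_scale /word_map map_cat -!map_comp.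
by congr (_ ++ _); apply: eq_map => -[m [x y]] /=; rewrite pullZ.
Qed.

Lemma coend_push_linm c a a' r (f f' : Hom a a') (u : coend_obj c a) :
  coend_push (r *: f + f') u = r *: coend_push f u + coend_push f' u.
Proof.
rewrite -[u]reprK !coend_pushE coend_linE; apply/coend_piP.
rewrite /word_scale {2}/word_map -map_comp.
apply: word_interleave => -[m [x y]] /=; rewrite push_linm.
apply: (ce_trans (ce_addr _ _ _)); rewrite -cat1s -[X in coend_eq _ X]cat1s.
by apply: ce_cat; [apply: ce_sym; exact: ce_scale|exact: ce_refl].
Qed.

Lemma coend_pull_linm c c' a r (g g' : Hom c' c) (u : coend_obj c a) :
  coend_pull (r *: g + g') u = r *: coend_pull g u + coend_pull g' u.
Proof.
rewrite -[u]reprK !coend_pullE coend_linE; apply/coend_piP.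
rewrite /word_scale {2}/word_map -map_comp.
by apply: word_interleave => -[m [x y]] /=; rewrite pull_linm; exact: ce_addl.
Qed.

Definition coend : bimod C := @Bimod R C (fun c a => coend_obj c a : lmodType R)
  coend_push coend_pull coend_push_id coend_push_comp coend_pull_id
  coend_pull_comp coend_push_pull coend_push_lin coend_pull_lin
  coend_push_linm coend_pull_linm.

Definition tensor (c a m : C) (x : F c m) (y : G m a) : coend c a :=
  \pi_(coend_obj c a) ([:: tens x y] : word c a).

Lemma coend_universal (c a : C) (V : lmodType R)
    (beta : forall m, F c m -> G m a -> V) :
  (forall m r (x x' : F c m) (y : G m a),
     beta m (r *: x + x') y = r *: beta m x y + beta m x' y) ->
  (forall m r (x : F c m) (y y' : G m a),
     beta m x (r *: y + y') = r *: beta m x y + beta m x y') ->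
  (forall m m' (h : Hom m m') (x : F c m) (y : G m' a),
     beta m' (push h x) y = beta m x (pull h y)) ->
  exists phi : {linear coend c a -> V},
    (forall m (x : F c m) (y : G m a), phi (tensor x y) = beta m x y) /\
    forall psi : {linear coend c a -> V},
      (forall m (x : F c m) (y : G m a), psi (tensor x y) = beta m x y) ->
      psi =1 phi.
Proof.
move=> bl br bb.
have blD m x x' y : beta m (x + x') y = beta m x y + beta m x' y.
  by have := bl m 1 x x' y; rewrite !scale1r.
have bl0 m y : beta m 0 y = 0.
  by apply: (addrI (beta m 0 y)); rewrite -blD !addr0.
have blZ m r x y : beta m (r *: x) y = r *: beta m x y.
  by have := bl m r x 0 y; rewrite bl0 !addr0.
have brD m x y y' : beta m x (y + y') = beta m x y + beta m x y'.
  by have := br m 1 x y y'; rewrite !scale1r.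
have br0 m x : beta m x 0 = 0.
  by apply: (addrI (beta m x 0)); rewrite -brD !addr0.
have brZ m r x y : beta m x (r *: y) = r *: beta m x y.
  by have := br m r x y 0; rewrite br0 !addr0.
pose ev (s : seq (symb c a)) : V :=
  \sum_(t <- s) beta _ (projT2 t).1 (projT2 t).2.
have evE s t : coend_eq s t -> ev s = ev t.
  elim=> {s t} // [s t u _ -> _ ->|s s' t t' _ ss _ tt|s t|m y|m x x' y
    |m x y y'|m r x y|m m' h x y] //.
  - by rewrite /ev !big_cat -/(ev s) -/(ev t) ss tt.
  - by rewrite /ev !big_cat; exact: addrC.
  - by rewrite /ev big_cons !big_nil /= addr0 bl0.
  - by rewrite /ev !big_cons !big_nil /= !addr0 blD.
  - by rewrite /ev !big_cons !big_nil /= !addr0 brD.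
  - by rewrite /ev !big_cons !big_nil /= !addr0 blZ brZ.
  - by rewrite /ev !big_cons !big_nil /= !addr0 bb.
pose phi0 (u : coend c a) : V := ev (repr (u : coend_obj c a)).
have phiE (s : word c a) : phi0 (wcl s) = ev s.
  by apply: evE; exact: coend_reprP.
have phil : linear phi0.
  move=> r u v; rewrite -[u in LHS]reprK -[v in LHS]reprK.
  rewrite [X in phi0 X]coend_linE phiE /ev big_cat /= big_map scaler_sumr.
  by congr (_ + _); apply: eq_bigr => t _; rewrite /= blZ.
pose phi : {linear coend c a -> V} :=
  HB.pack phi0 (GRing.isLinear.Build R (coend c a) V *:%R phi0 phil).
exists phi; split=> [m x y|psi psiE u].
  by rewrite -[LHS]/(phi0 (wcl _)) phiE /ev big_cons big_nil addr0.
rewrite -[u]reprK -[RHS]/(phi0 (wcl _)) phiE.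
elim: (repr _ : seq _) => [|[m [x y]] s IHs].
  by rewrite /ev big_nil; exact: linear0.
rewrite /ev big_cons -/(ev s) -IHs /= -psiE -raddfD; congr (psi _); symmetry.
by rewrite -[LHS]/(coend_add _ _) coend_addE.
Qed.

End Coend.

Definition seq_equiv (R : comPzRingType) (C : linCat R) (a b b' c : C)
    (x : Hom a b) (y : Hom b c) (x' : Hom a b') (y' : Hom b' c) : Prop :=
  exists f : Hom b b', is_iso f /\ f ∘ x = x' /\ y' ∘ f = y.

Definition ext_sum (R : comPzRingType) (C : linCat R) (E : bimod C)
    (a a' p c c' q : C) (s : biprod a a' p) (t : biprod c c' q)
    (d : E c a) (d' : E c' a') : E q p :=
  push (in1 s) (pull (pr1 t) d) + push (in2 s) (pull (pr2 t) d').

(* [real x y d] stands for s(d) = [a -x-> b -y-> c]; [realE] and [realP] say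
   that s(d) is exactly one equivalence class of sequences. *)
Record extriCat (R : comPzRingType) := ExtriCat {
  et_cat :> addCat R;
  EE : bimod et_cat;
  real : forall a b c : et_cat, Hom a b -> Hom b c -> EE c a -> Prop;
  realE : forall a c (d : EE c a),
    exists b (x : Hom a b) (y : Hom b c), real x y d;
  realP : forall a b b' c (x : Hom a b) (y : Hom b c) (x' : Hom a b')
      (y' : Hom b' c) (d : EE c a), real x y d ->
    (real x' y' d <-> seq_equiv x y x' y');
  real_mor : forall a b c a' b' c' (x : Hom a b) (y : Hom b c) (d : EE c a)
      (x' : Hom a' b') (y' : Hom b' c') (d' : EE c' a')
      (f : Hom a a') (h : Hom c c'),
    real x y d -> real x' y' d' -> push f d = pull h d' ->
    exists g : Hom b b', g ∘ x = x' ∘ f /\ y' ∘ g = h ∘ y;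
  real_split : forall a c p (s : biprod a c p), real (in1 s) (pr2 s) 0;
  real_sum : forall a b c a' b' c' (x : Hom a b) (y : Hom b c) (d : EE c a)
      (x' : Hom a' b') (y' : Hom b' c') (d' : EE c' a') pa pb pc
      (sa : biprod a a' pa) (sb : biprod b b' pb) (sc : biprod c c' pc),
    real x y d -> real x' y' d' ->
    real (biprod_map sa sb x x') (biprod_map sb sc y y') (ext_sum sa sc d d');
  ET3 : forall a b c a' b' c' (x : Hom a b) (y : Hom b c) (d : EE c a)
      (x' : Hom a' b') (y' : Hom b' c') (d' : EE c' a')
      (f : Hom a a') (g : Hom b b'),
    real x y d -> real x' y' d' -> g ∘ x = x' ∘ f ->
    exists h : Hom c c', h ∘ y = y' ∘ g /\ push f d = pull h d';
  ET3op : forall a b c a' b' c' (x : Hom a b) (y : Hom b c) (d : EE c a)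
      (x' : Hom a' b') (y' : Hom b' c') (d' : EE c' a')
      (g : Hom b b') (h : Hom c c'),
    real x y d -> real x' y' d' -> h ∘ y = y' ∘ g ->
    exists f : Hom a a', g ∘ x = x' ∘ f /\ push f d = pull h d';
  ET4 : forall a b d c f0 (f : Hom a b) (f' : Hom b d) (g : Hom b c)
      (g' : Hom c f0) (del : EE d a) (del' : EE f0 b),
    real f f' del -> real g g' del' ->
    exists e (h' : Hom c e) (k : Hom d e) (l : Hom e f0) (del'' : EE e a),
      h' ∘ g = k ∘ f' /\ l ∘ h' = g' /\
      real (g ∘ f) h' del'' /\
      real k l (push f' del') /\
      pull k del'' = del /\
      push f del'' = pull l del';
  ET4op : forall d a b f0 c (f' : Hom d a) (f : Hom a b) (g' : Hom f0 b)
      (g : Hom b c) (del : EE b d) (del' : EE c f0),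
    real f' f del -> real g' g del' ->
    exists e (k : Hom d e) (l : Hom e f0) (h' : Hom e a) (del'' : EE c e),
      h' ∘ k = f' /\ f ∘ h' = g' ∘ l /\
      real h' (g ∘ f) del'' /\
      real k l (pull g' del) /\
      push l del'' = del' /\
      push k del = pull g del'' }.

(* Positive extensions: E^1 = E and E^(i+1) is the tensor product of E^i and
   E over C.  Only i >= 1 is meaningful; [Ext C 0] is E as well. *)
Definition Ext (R : comPzRingType) (C : extriCat R) (i : nat) : bimod C :=
  iter i.-1 (fun F => coend F (EE C)) (EE C).

Record addSub (R : comPzRingType) (C : addCat R) := AddSub {
  sub_mem :> C -> Prop;
  sub_iso : forall a b, isomorphic a b -> sub_mem a -> sub_mem b;
  sub_zero : forall z, zero_object z -> sub_mem z;
  sub_sum : forall a b p, biprod a b p -> sub_mem a -> sub_mem b -> sub_mem p;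
  sub_summand : forall a b p, biprod a b p -> sub_mem p ->
    sub_mem a /\ sub_mem b }.

Section Rigid.
Variables (R : comPzRingType) (C : extriCat R) (X : addSub C).

Definition rigid (n : nat) : Prop :=
  forall i, (1 <= i <= n)%N -> forall a b : C, X a -> X b ->
  forall e : Ext C i a b, e = 0.

Definition lperp (i : nat) : set C :=
  [set a | forall b : C, X b -> forall e : Ext C i a b, e = 0].

Definition rperp (i : nat) : set C :=
  [set a | forall b : C, X b -> forall e : Ext C i b a, e = 0].

Definition left_approx (a m : C) (x : Hom a m) : Prop :=
  X m /\ forall m' (f : Hom a m'), X m' -> exists g : Hom m m', f = g ∘ x.

Definition right_approx (a m : C) (y : Hom m a) : Prop :=
  X m /\ forall m' (f : Hom m' a), X m' -> exists g : Hom m' m, f = y ∘ g.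

Definition strongly_cov_finite : Prop :=
  forall a : C, exists (m c : C) (x : Hom a m) (y : Hom m c) (d : EE C c a),
    real x y d /\ left_approx x.

Definition strongly_contrav_finite : Prop :=
  forall a : C, exists (k m : C) (x : Hom k m) (y : Hom m a) (d : EE C a k),
    real x y d /\ right_approx y.

(* The data a -> X_a -> a^+ -->; the suspension depends on the choice of one
   such E-triangle for every a. *)
Record left_tri (a : C) := LeftTri {
  lt_mid : C;
  lt_plus : C;
  lt_x : Hom a lt_mid;
  lt_y : Hom lt_mid lt_plus;
  lt_d : EE C lt_plus a;
  lt_real : real lt_x lt_y lt_d;
  lt_approx : left_approx lt_x }.

(* The data a^- -> X^a -> a -->. *)
Record right_tri (a : C) := RightTri {
  rt_minus : C;
  rt_mid : C;
  rt_x : Hom rt_minus rt_mid;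
  rt_y : Hom rt_mid a;
  rt_d : EE C a rt_minus;
  rt_real : real rt_x rt_y rt_d;
  rt_approx : right_approx rt_y }.

End Rigid.

Section IdealQuotient.
Variables (R : comPzRingType) (C : addCat R) (X : addSub C).

Definition factors (a b : C) (f : Hom a b) : Prop :=
  exists (m : C) (u : Hom a m) (v : Hom m b), X m /\ f = v ∘ u.

Lemma factors0 a b : factors (0 : Hom a b).
Proof.
have [z z0] := has_zero C.
by exists z, 0, 0; split; [exact: sub_zero|rewrite comp0l].
Qed.

Lemma factorsD a b (f g : Hom a b) : factors f -> factors g -> factors (f + g).
Proof.
move=> [m [u [v [Xm ->]]]] [m' [u' [v' [Xm' ->]]]].
have [p [s]] := has_biprod m m'.
exists p, (in1 s ∘ u + in2 s ∘ u'), (v ∘ pr1 s + v' ∘ pr2 s).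
split; first exact: sub_sum s Xm Xm'.
rewrite compDr !compDl !compA -!(compA _ (pr1 s)) -!(compA _ (pr2 s)).
by rewrite pr1in1 pr2in2 pr1in2 pr2in1 !compm1 !comp0r !comp0l addr0 add0r.
Qed.

Lemma factorsZ a b r (f : Hom a b) : factors f -> factors (r *: f).
Proof.
by move=> [m [u [v [Xm ->]]]]; exists m, u, (r *: v); rewrite compZl.
Qed.

Lemma factorsN a b (f : Hom a b) : factors f -> factors (- f).
Proof. by rewrite -scaleN1r; exact: factorsZ. Qed.

Lemma factors_compl a b c (g : Hom b c) (f : Hom a b) :
  factors f -> factors (g ∘ f).
Proof.
by move=> [m [u [v [Xm ->]]]]; exists m, u, (g ∘ v); rewrite compA.
Qed.

Lemma factors_compr a b c (g : Hom b c) (f : Hom a b) :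
  factors g -> factors (g ∘ f).
Proof.
by move=> [m [u [v [Xm ->]]]]; exists m, (u ∘ f), v; rewrite compA.
Qed.

Definition qrel (a b : C) : rel (Hom a b) := fun f g => `[< factors (f - g) >].

Lemma qrel_refl a b : reflexive (@qrel a b).
Proof. by move=> f; apply/asboolP; rewrite subrr; exact: factors0. Qed.

Lemma qrel_sym a b : symmetric (@qrel a b).
Proof.
by move=> f g; apply/asboolP/asboolP => /factorsN; rewrite opprB.
Qed.

Lemma qrel_trans a b : transitive (@qrel a b).
Proof.
move=> g f h /asboolP fg /asboolP gh; apply/asboolP.
by rewrite -(subrKA g); exact: factorsD.
Qed.

Canonical qequiv (a b : C) : equiv_rel (Hom a b) :=
  EquivRel (@qrel a b) (@qrel_refl a b) (@qrel_sym a b) (@qrel_trans a b).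

Definition qhom (a b : C) : Type := {eq_quot (qequiv a b)}.
HB.instance Definition _ a b := Choice.on (qhom a b).
HB.instance Definition _ a b := EqQuotient.on (qhom a b).

Local Notation qcl f := (\pi_(qhom _ _) f).

Lemma qhom_piP a b (f g : Hom a b) :
  \pi_(qhom a b) f = \pi_(qhom a b) g <-> factors (f - g).
Proof. by split=> [/eqmodP/asboolP//|fg]; apply/eqmodP/asboolP. Qed.

Lemma qhom_reprP a b (f : Hom a b) : factors (repr (\pi_(qhom a b) f) - f).
Proof. by apply/qhom_piP; rewrite reprK. Qed.

Section Module.
Variables a b : C.
Implicit Types u v : qhom a b.

Definition qhom_zero : qhom a b := qcl (0 : Hom a b).
Definition qhom_add u v : qhom a b := qcl (repr u + repr v).
Definition qhom_opp u : qhom a b := qcl (- repr u).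
Definition qhom_scale (r : R) u : qhom a b := qcl (r *: repr u).

Lemma qhom_addE (f g : Hom a b) :
  qhom_add (qcl f) (qcl g) = qcl (f + g).
Proof.
by apply/qhom_piP; rewrite opprD addrACA; apply: factorsD; exact: qhom_reprP.
Qed.

Lemma qhom_oppE (f : Hom a b) : qhom_opp (qcl f) = qcl (- f).
Proof.
by apply/qhom_piP; rewrite -opprD; apply: factorsN; exact: qhom_reprP.
Qed.

Lemma qhom_scaleE r (f : Hom a b) : qhom_scale r (qcl f) = qcl (r *: f).
Proof.
by apply/qhom_piP; rewrite -scalerBr; apply: factorsZ; exact: qhom_reprP.
Qed.

Lemma qhom_addA : associative qhom_add.
Proof.
move=> u v w; rewrite -[u]reprK -[v]reprK -[w]reprK.
rewrite [qhom_add (qcl (repr v)) _]qhom_addE.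
by rewrite [qhom_add _ (qcl (repr v))]qhom_addE !qhom_addE addrA.
Qed.

Lemma qhom_addC : commutative qhom_add.
Proof. by move=> u v; rewrite -[u]reprK -[v]reprK !qhom_addE addrC. Qed.

Lemma qhom_add0 : left_id qhom_zero qhom_add.
Proof. by move=> u; rewrite -[u]reprK qhom_addE add0r. Qed.

Lemma qhom_addN : left_inverse qhom_zero qhom_opp qhom_add.
Proof. by move=> u; rewrite -[u]reprK qhom_oppE qhom_addE addNr. Qed.

HB.instance Definition _ := GRing.isZmodule.Build (qhom a b)
  qhom_addA qhom_addC qhom_add0 qhom_addN.

Lemma qhom_scaleA r q u : qhom_scale r (qhom_scale q u) = qhom_scale (r * q) u.
Proof.
by rewrite -[u]reprK [qhom_scale q _]qhom_scaleE !qhom_scaleE scalerA.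
Qed.

Lemma qhom_scale1 : left_id 1 qhom_scale.
Proof. by move=> u; rewrite -[u]reprK qhom_scaleE scale1r. Qed.

Lemma qhom_scaleDr : right_distributive qhom_scale +%R.
Proof.
move=> r u v; rewrite -[u]reprK -[v]reprK.
rewrite -[LHS]/(qhom_scale r (qhom_add _ _)) qhom_addE !qhom_scaleE.
by rewrite -[RHS]/(qhom_add _ _) qhom_addE scalerDr.
Qed.

Lemma qhom_scaleDl u : {morph qhom_scale^~ u : r q / r + q}.
Proof.
move=> r q; rewrite -[u]reprK !qhom_scaleE.
by rewrite -[RHS]/(qhom_add _ _) qhom_addE scalerDl.
Qed.

HB.instance Definition _ := GRing.Zmodule_isLmodule.Build R (qhom a b)
  qhom_scaleA qhom_scale1 qhom_scaleDr qhom_scaleDl.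

End Module.

Definition qcomp (a b c : C) (g : qhom b c) (f : qhom a b) : qhom a c :=
  qcl (repr g ∘ repr f).

Lemma qcompE a b c (g : Hom b c) (f : Hom a b) :
  qcomp (qcl g) (qcl f) = qcl (g ∘ f).
Proof.
apply/qhom_piP; set g' := repr _; set f' := repr _.
have -> : g' ∘ f' - g ∘ f = (g' - g) ∘ f' + g ∘ (f' - f).
  by rewrite compDl compDr compNl compNr subrKA.
apply: factorsD; first by apply: factors_compr; exact: qhom_reprP.
by apply: factors_compl; exact: qhom_reprP.
Qed.

Lemma qhom_linE a b r (f g : Hom a b) :
  r *: (qcl f : qhom a b) + qcl g = qcl (r *: f + g).
Proof.
by rewrite -[LHS]/(qhom_add (qhom_scale _ _) _) qhom_scaleE qhom_addE.
Qed.

Program Definition quot_cat : linCat R :=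
  @LinCat R C (fun a b => qhom a b : lmodType R)
    (fun a => \pi_(qhom a a) (idm a)) qcomp _ _ _ _ _.
Next Obligation. by move=> a b f; rewrite -[f]reprK qcompE comp1m. Qed.
Next Obligation. by move=> a b f; rewrite -[f]reprK qcompE compm1. Qed.
Next Obligation.
move=> a b c d h g f; rewrite -[f]reprK -[g]reprK -[h]reprK.
rewrite [qcomp (qcl (repr g)) _]qcompE.
by rewrite [qcomp _ (qcl (repr g))]qcompE !qcompE compA.
Qed.
Next Obligation.
move=> a b c f r g g'; rewrite -[f]reprK -[g]reprK -[g']reprK.
by rewrite qhom_linE !qcompE qhom_linE comp_linl.
Qed.
Next Obligation.
move=> a b c g r f f'; rewrite -[f]reprK -[g]reprK -[f']reprK.
by rewrite qhom_linE !qcompE qhom_linE comp_linr.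
Qed.

Program Definition quot_functor : functor C quot_cat :=
  @Functor R C quot_cat id (fun a b f => \pi_(qhom a b) f) _ _.
Next Obligation. by []. Qed.
Next Obligation. by move=> * /=; rewrite -qcompE. Qed.

End IdealQuotient.

Section Exactness.
Variables (R : comPzRingType) (C : extriCat R).

Lemma biprod_zero_right (a z : C) : zero_object z -> biprod a z a.
Proof.
move=> [z1 z2]; exists (idm a) 0 (idm a) 0;
  by rewrite ?comp1m ?comp0l ?addr0.
Qed.

Lemma biprod_zero_left (a z : C) : zero_object z -> biprod z a a.
Proof.
move=> [z1 z2]; exists 0 (idm a) 0 (idm a);
  by rewrite ?comp1m ?comp0l ?comp0r ?add0r.
Qed.

Lemma push_inflation a b c (x : Hom a b) (y : Hom b c) (d : EE C c a) :
  real x y d -> push x d = 0.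
Proof.
move=> xyd; have [z z0] := has_zero C.
have r0 := real_split (biprod_zero_right b z0).
have [//|h [_ ->]] := ET3 (f := x) (g := in1 (biprod_zero_right b z0)) xyd r0.
by rewrite pull0.
Qed.

Lemma pull_deflation a b c (x : Hom a b) (y : Hom b c) (d : EE C c a) :
  real x y d -> pull y d = 0.
Proof.
move=> xyd; have [z z0] := has_zero C.
have r0 := real_split (biprod_zero_left b z0).
have [//|f [_ <-]] := ET3op (h := y) (g := pr2 (biprod_zero_left b z0)) r0 xyd.
by rewrite push0.
Qed.

Lemma lift_deflation a b c (x : Hom a b) (y : Hom b c) (d : EE C c a) c'
    (h : Hom c' c) :
  real x y d -> pull h d = 0 -> exists w : Hom c' b, h = y ∘ w.
Proof.
move=> xyd hd; have [z z0] := has_zero C.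
have r0 := real_split (biprod_zero_left c' z0).
have [|w [_ yw]] := real_mor (f := 0) (h := h) r0 xyd.
  by rewrite push0 hd.
exists (w ∘ in2 (biprod_zero_left c' z0)).
by rewrite compA yw -compA pr2in2 compm1.
Qed.

Lemma extend_inflation a b c (x : Hom a b) (y : Hom b c) (d : EE C c a) a'
    (f : Hom a a') :
  real x y d -> push f d = 0 -> exists w : Hom b a', f = w ∘ x.
Proof.
move=> xyd fd; have [z z0] := has_zero C.
have r0 := real_split (biprod_zero_right a' z0).
have [|w [wx _]] := real_mor (f := f) (h := 0) xyd r0.
  by rewrite pull0 fd.
exists (pr1 (biprod_zero_right a' z0) ∘ w).
by rewrite -compA wx compA pr1in1 comp1m.
Qed.

Definition tri_mor a b c a' b' c' (x : Hom a b) (y : Hom b c) (d : EE C c a)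
    (x' : Hom a' b') (y' : Hom b' c') (d' : EE C c' a')
    (f : Hom a a') (g : Hom b b') (h : Hom c c') : Prop :=
  [/\ g ∘ x = x' ∘ f, h ∘ y = y' ∘ g & push f d = pull h d'].

End Exactness.

Section Suspension.
Variables (R : comPzRingType) (C : extriCat R) (X : addSub C).
Variable T : forall a : C, left_tri X a.

Definition lt_mor (a b : C) (f : Hom a b)
    (g : Hom (lt_mid (T a)) (lt_mid (T b)))
    (h : Hom (lt_plus (T a)) (lt_plus (T b))) : Prop :=
  tri_mor (lt_x (T a)) (lt_y (T a)) (lt_d (T a))
          (lt_x (T b)) (lt_y (T b)) (lt_d (T b)) f g h.

Lemma lt_complete (a b : C) (f : Hom a b) : exists h g, lt_mor f g h.
Proof.
have [Xb _] := lt_approx (T b); have [_ ext] := lt_approx (T a).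
have [g gx] := ext _ (lt_x (T b) ∘ f) Xb.
have [h [hy hd]] := ET3 (lt_real (T a)) (lt_real (T b)) (esym gx).
by exists h, g.
Qed.

Lemma lt_mor_factors (a b : C) (f f' : Hom a b) g g' h h' :
  lt_mor f g h -> lt_mor f' g' h' -> factors X (f - f') -> factors X (h - h').
Proof.
move=> [_ _ fh] [_ _ fh'] [m [u [v [Xm ff']]]].
have [_ /(_ m u Xm)[w uw]] := lt_approx (T a).
have [|k ->] := lift_deflation (h := h - h') (lt_real (T b)).
  rewrite pullmB -fh -fh' -pushmB ff' uw compA push_comp.
  by rewrite (push_inflation (lt_real _)) push0.
by exists (lt_mid (T b)), k, (lt_y (T b)); have [] := lt_approx (T b).
Qed.

Definition susp_mor (a b : C) (f : qhom X a b)
    : qhom X (lt_plus (T a)) (lt_plus (T b)) :=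
  \pi_(qhom _ _ _) (projT1 (cid (lt_complete (repr f)))).

Lemma susp_morE (a b : C) (f : Hom a b) g h : lt_mor f g h ->
  susp_mor (\pi_(qhom _ _ _) f) = \pi_(qhom _ _ _) h.
Proof.
move=> fgh; apply/qhom_piP; case: cid => h' /= [g' fgh'].
exact: lt_mor_factors fgh' fgh (qhom_reprP _ _).
Qed.

Program Definition suspension : functor (quot_cat X) (quot_cat X) :=
  @Functor R (quot_cat X) (quot_cat X) (fun a => lt_plus (T a)) susp_mor _ _.
Next Obligation.
move=> a; apply: (susp_morE (g := idm _)).
by split; rewrite ?comp1m ?compm1 ?push_id ?pull_id.
Qed.
Next Obligation.
move=> a b c g f; rewrite -[f]reprK -[g]reprK.
have [h [k [kx hy hd]]] := lt_complete (repr f).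
have [h' [k' [kx' hy' hd']]] := lt_complete (repr g).
rewrite -[LHS]/(susp_mor (qcomp _ _)) -[RHS]/(qcomp (susp_mor _) (susp_mor _)).
rewrite qcompE (susp_morE (g := k) (h := h)) //.
rewrite (susp_morE (g := k') (h := h')) // qcompE.
apply: (susp_morE (g := k' ∘ k)); split.
- by rewrite -compA kx !compA kx'.
- by rewrite -compA hy !compA hy'.
- by rewrite push_comp hd push_pull hd' pull_comp.
Qed.

End Suspension.

Section Loop.
Variables (R : comPzRingType) (C : extriCat R) (X : addSub C).
Variable T : forall a : C, right_tri X a.

Definition rt_mor (a b : C) (f : Hom a b)
    (g : Hom (rt_mid (T a)) (rt_mid (T b)))
    (h : Hom (rt_minus (T a)) (rt_minus (T b))) : Prop :=
  tri_mor (rt_x (T a)) (rt_y (T a)) (rt_d (T a))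
          (rt_x (T b)) (rt_y (T b)) (rt_d (T b)) h g f.

Lemma rt_complete (a b : C) (f : Hom a b) : exists h g, rt_mor f g h.
Proof.
have [Xa _] := rt_approx (T a); have [_ lift] := rt_approx (T b).
have [g gy] := lift _ (f ∘ rt_y (T a)) Xa.
have [h [hx hd]] := ET3op (rt_real (T a)) (rt_real (T b)) gy.
by exists h, g.
Qed.

Lemma rt_mor_factors (a b : C) (f f' : Hom a b) g g' h h' :
  rt_mor f g h -> rt_mor f' g' h' -> factors X (f - f') -> factors X (h - h').
Proof.
move=> [_ _ fh] [_ _ fh'] [m [u [v [Xm ff']]]].
have [_ /(_ m v Xm)[w vw]] := rt_approx (T b).
have [|k ->] := extend_inflation (f := h - h') (rt_real (T a)).
  rewrite pushmB fh fh' -pullmB ff' vw -compA pull_comp.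
  by rewrite (pull_deflation (rt_real _)) pull0.
by exists (rt_mid (T a)), (rt_x (T a)), k; have [] := rt_approx (T a).
Qed.

Definition loop_mor (a b : C) (f : qhom X a b)
    : qhom X (rt_minus (T a)) (rt_minus (T b)) :=
  \pi_(qhom _ _ _) (projT1 (cid (rt_complete (repr f)))).

Lemma loop_morE (a b : C) (f : Hom a b) g h : rt_mor f g h ->
  loop_mor (\pi_(qhom _ _ _) f) = \pi_(qhom _ _ _) h.
Proof.
move=> fgh; apply/qhom_piP; case: cid => h' /= [g' fgh'].
exact: rt_mor_factors fgh' fgh (qhom_reprP _ _).
Qed.

Program Definition loop : functor (quot_cat X) (quot_cat X) :=
  @Functor R (quot_cat X) (quot_cat X) (fun a => rt_minus (T a)) loop_mor _ _.
Next Obligation.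
move=> a; apply: (loop_morE (g := idm _)).
by split; rewrite ?comp1m ?compm1 ?push_id ?pull_id.
Qed.
Next Obligation.
move=> a b c g f; rewrite -[f]reprK -[g]reprK.
have [h [k [kx hy hd]]] := rt_complete (repr f).
have [h' [k' [kx' hy' hd']]] := rt_complete (repr g).
rewrite -[LHS]/(loop_mor (qcomp _ _)) -[RHS]/(qcomp (loop_mor _) (loop_mor _)).
rewrite qcompE (loop_morE (g := k) (h := h)) //.
rewrite (loop_morE (g := k') (h := h')) // qcompE.
apply: (loop_morE (g := k' ∘ k)); split.
- by rewrite -compA kx !compA kx'.
- by rewrite -compA hy !compA hy'.
- by rewrite push_comp hd push_pull hd' pull_comp.
Qed.

End Loop.

Definition Tr_plus (R : comPzRingType) (C : extriCat R) (X : addSub C)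
    (T : forall a : C, left_tri X a) (n : nat) : set C :=
  [set a | iso_zero (pow_functor (suspension T) n (quot_functor X a))].

Definition Tr_minus (R : comPzRingType) (C : extriCat R) (X : addSub C)
    (T : forall a : C, right_tri X a) (n : nat) : set C :=
  [set a | iso_zero (pow_functor (loop T) n (quot_functor X a))].

(* Main.v *)
Require Import Defs.
From mathcomp Require Import all_boot all_algebra.
From mathcomp Require Import boolp classical_sets.
(* all_algebra rebinds Hom to linear maps; this restores the categorical Hom. *)
Import Defs.

(** Write A_k for the k-th object of the tower of approximation E-triangles
    starting at A.  The n-th suspension (or loop) of A is zero in C/[X] exactly
    when the identity of A_n factors through an object of X; this does not put
    A_n in X, since idempotents of C may fail to split.

    The proof looks at the Yoneda product of the n classes of the tower.  In
    the suspension case it lies in E^n(A_n, A): as the identity of A_n factors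
    through X and E^n(X, A) = 0, it vanishes.  The exact sequence

      E^i(W, B) -> E^i(W, C) -> E^(i+1)(W, A)

    of an E-triangle A -> B -> C, whose second map is the product with the
    class of the triangle, allows the last factor of the product to be
    cancelled as soon as E^i(W, B) = 0 for the approximating object B; here
    W = A_n and the vanishing is rigidity.  After n - 1 cancellations the class
    of the triangle starting at A_(n-1) is zero, so A_(n-1) is a direct summand
    of an object of X ([cosyz_class0]).  This is more than the hypothesis for
    n - 1, and an induction reaches A itself ([cosyz_mem]).

    In the loop case the product lies in E^n(A, A_n) and the same cancellation,
    now with W = A and E^i(A, X) = 0, ends at the class of the very first
    triangle, so that A is a summand at once ([syz_class0]).  Thus the covariant
    sequence serves both parts.

    What remains is the exactness of the displayed sequence for the coend
    definition of E^(i+1) ([tensor_eq0]).  It is proved for the tensor product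
    of any half exact bimodule F with E.  Every class d in E(Z, A) generates a
    finitely presented subfunctor of E(-, A), the defect of its E-triangle
    A -> B -> Z, and these subfunctors are directed because C has direct sums.
    Hence F (x) E is the colimit of the quotients of F(W, Z) by the image of
    F(W, B), and a tensor v (x) d is zero only if v dies in such a quotient
    further along the colimit.  The homotopy cartesian square of a morphism of
    E-triangles with the same first term shows that the transition maps are
    injective ([in_defect_reflect]), so v already dies in the quotient attached
    to d.  Half exactness passes from F to F (x) E ([coend_half_exact]), which
    lets the argument be iterated. *)

Set Implicit Arguments.
Unset Strict Implicit.
Unset Printing Implicit Defensive.

Import GRing.Theory.
Local Open Scope ring_scope.
Local Open Scope quotient_scope.
Local Open Scope cat_scope.

(** * Bimodules and direct sums *)

Section BimoduleComplements.
Variables (R : comPzRingType) (C : linCat R) (F : bimod C).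

Lemma push0l c a a' (e : F c a) : push (0 : Hom a a') e = 0.
Proof. by have := pushmB (0 : Hom a a') 0 e; rewrite !subrr. Qed.

Lemma pull0l c c' a (e : F c a) : pull (0 : Hom c' c) e = 0.
Proof. by have := pullmB (0 : Hom c' c) 0 e; rewrite !subrr. Qed.

Lemma pushDl c a a' (f f' : Hom a a') (e : F c a) :
  push (f + f') e = push f e + push f' e.
Proof. by have := push_linm 1 f f' e; rewrite !scale1r. Qed.

Lemma pullDl c c' a (g g' : Hom c' c) (e : F c a) :
  pull (g + g') e = pull g e + pull g' e.
Proof. by have := pull_linm 1 g g' e; rewrite !scale1r. Qed.

Lemma pushZl c a a' r (f : Hom a a') (e : F c a) :
  push (r *: f) e = r *: push f e.
Proof. by have := push_linm r f 0 e; rewrite push0l !addr0. Qed.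

Lemma pullZl c c' a r (g : Hom c' c) (e : F c a) :
  pull (r *: g) e = r *: pull g e.
Proof. by have := pull_linm r g 0 e; rewrite pull0l !addr0. Qed.

Lemma pushN c a a' (f : Hom a a') (e : F c a) : push f (- e) = - push f e.
Proof. by rewrite -scaleN1r pushZ scaleN1r. Qed.

Lemma pushB c a a' (f : Hom a a') (e e' : F c a) :
  push f (e - e') = push f e - push f e'.
Proof. by rewrite pushD pushN. Qed.

End BimoduleComplements.

Section Tensor.
Variables (R : comPzRingType) (C : linCat R) (F G : bimod C).

Lemma tensor_balance c a m m' (h : Hom m m') (x : F c m) (y : G m' a) :
  tensor (push h x) y = tensor x (pull h y).
Proof. by apply/coend_piP; exact: ce_balance. Qed.

Lemma push_tensor c a a' m (f : Hom a a') (x : F c m) (y : G m a) :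
  push f (tensor x y) = tensor x (push f y).
Proof. by rewrite [LHS]coend_pushE. Qed.

End Tensor.

Section ZeroBiproduct.
Variables (R : comPzRingType) (C : linCat R).

Lemma biprod_zeror (a o : C) : zero_object o ->
  exists s : biprod a o a, in1 s = idm a.
Proof.
move=> [o1 o2].
by unshelve eexists (@Biprod _ _ _ _ _ (idm a) 0 (idm a) 0 _ _ _ _ _);
  rewrite // ?comp1m ?comp0l ?comp0r ?addr0.
Qed.

Lemma biprod_zerol (a o : C) : zero_object o ->
  exists s : biprod o a a, pr2 s = idm a.
Proof.
move=> [o1 o2].
by unshelve eexists (@Biprod _ _ _ _ _ 0 (idm a) 0 (idm a) _ _ _ _ _);
  rewrite // ?comp1m ?comp0l ?comp0r ?add0r.
Qed.

(** The decomposition of p is changed by a shear: the graph of h is another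
    complement of a. *)
Lemma biprod_shear (a b p : C) (s : biprod a b p) (h : Hom b a) :
  exists s' : biprod b a p,
    in1 s' = in1 s ∘ h + in2 s /\ pr2 s' = pr1 s - h ∘ pr2 s.
Proof.
unshelve eexists (@Biprod _ _ _ _ _ (in1 s ∘ h + in2 s) (in1 s)
  (pr2 s) (pr1 s - h ∘ pr2 s) _ _ _ _ _) => //.
- by rewrite compDr compA pr2in1 comp0l add0r pr2in2.
- by rewrite compDl compNl -compA pr2in1 comp0r subr0 pr1in1.
- exact: pr2in1.
- rewrite compDl compNl !compDr !compA pr1in1 comp1m pr1in2 addr0 -!(compA h).
  by rewrite pr2in1 pr2in2 comp0l comp0r add0r compm1 subrr.
- rewrite compDr compDl compNr !compA.
  by rewrite addrC addrA subrK biprod_id.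
Qed.

End ZeroBiproduct.

(** * Half exact bimodules and defects *)

Section Defect.
Variables (R : comPzRingType) (C : extriCat R).

Definition half_exact (F : bimod C) : Prop :=
  forall (a b c : C) (x : Hom a b) (y : Hom b c) (d : EE C c a), real x y d ->
  forall (w : C) (e : F w b), push y e = 0 -> exists e' : F w a, e = push x e'.

(** With e realised by b -> m -> w, the octahedral axiom applied to
    a -> b -> m turns push y e into the class of an E-triangle with third term
    w; it splits, and pulling the class of a -> m back along a section gives a
    preimage of e. *)
Lemma EE_half_exact : half_exact (EE C).
Proof.
move=> a b c x y d xyd w e ye0.
have [m [f [g fge]]] := realE e.
have [q [h [k [l [d2 [_ [_ [_ [klr [_ xd2]]]]]]]]]] := ET4 xyd fge.
rewrite ye0 in klr.
have [|s ls] := lift_deflation (h := idm w) klr; first by rewrite pull0.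
by exists (pull s d2); rewrite push_pull xd2 -pull_comp -ls pull_id.
Qed.

Section InDefect.
Variable F : bimod C.

(** The image of F(w, b) in F(w, z) for a realisation a -> b -> z of d.  For
    F = Hom the quotient of F(w, z) by it is the value at w of the subfunctor of
    E(-, a) generated by d. *)
Definition in_defect (w z a : C) (d : EE C z a) (v : F w z) : Prop :=
  exists (b : C) (p : Hom a b) (q : Hom b z) (t : F w b),
    real p q d /\ v = push q t.

Lemma push_in_defect w z z' a (h : Hom z z') (d : EE C z a) (d' : EE C z' a)
    (v : F w z) :
  d = pull h d' -> in_defect d v -> in_defect d' (push h v).
Proof.
move=> dh [b [p [q [t [pqd ->]]]]].
have [b' [p' [q' pqd']]] := realE d'.
have [|g [_ gq]] := real_mor (f := idm a) (h := h) pqd pqd'.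
  by rewrite push_id.
by exists b', p', q', (push g t); rewrite -!push_comp gq.
Qed.

Lemma in_defect_real w a b z (p : Hom a b) (q : Hom b z) (d : EE C z a)
    (v : F w z) :
  real p q d -> in_defect d v -> exists t, v = push q t.
Proof.
move=> pqd [b' [p' [q' [t [pqd' ->]]]]].
have [//|g [_ gq]] := real_mor (f := idm a) (h := idm z) pqd' pqd.
  by rewrite push_id pull_id.
by exists (push g t); rewrite -push_comp gq comp1m.
Qed.

Lemma in_defect0 w z a (d : EE C z a) : in_defect d (0 : F w z).
Proof.
by have [b [p [q pqd]]] := realE d; exists b, p, q, 0; rewrite push0.
Qed.

Lemma in_defectD w z a (d : EE C z a) (v v' : F w z) :
  in_defect d v -> in_defect d v' -> in_defect d (v + v').
Proof.
move=> [b [p [q [t [pqd ->]]]]] /(in_defect_real pqd)[t' ->].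
by exists b, p, q, (t + t'); rewrite pushD.
Qed.

Lemma in_defectN w z a (d : EE C z a) (v : F w z) :
  in_defect d v -> in_defect d (- v).
Proof.
by move=> [b [p [q [t [pqd ->]]]]]; exists b, p, q, (- t); rewrite pushN.
Qed.

(** Morphisms inducing the same class differ by one that factors through the
    deflation. *)
Lemma in_defect_lifts w m z a (h h' : Hom m z) (d : EE C z a) (x : F w m) :
  pull h d = pull h' d -> in_defect d (push h x - push h' x).
Proof.
move=> hh'; have [b [p [q pqd]]] := realE d.
have [|k kE] := lift_deflation (h := h - h') pqd.
  by rewrite pullmB hh' subrr.
by exists b, p, q, (push k x); rewrite -push_comp -kE pushmB.
Qed.

(** Together with [push_in_defect] this says that a morphism of E-triangles
    with identity first component is injective on defect quotients.  The
    square formed by b -> z and b' -> z' is homotopy cartesian, that is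
    b -> b' + z -> z' is an E-triangle: it is obtained from the octahedral
    axiom for the composite deflation b' + z -> z' + z -> z'.  Half exactness
    applied to it lifts the pair of v and u to F(w, b). *)
Lemma in_defect_reflect w z z' a (h : Hom z z') (d' : EE C z' a) (u : F w z) :
  half_exact F -> in_defect d' (push h u) -> in_defect (pull h d') u.
Proof.
move=> exF [b' [p' [q' [v [pqd' huE]]]]].
have [o o0] := has_zero C.
have [sa saE] := biprod_zeror a o0; have [so soE] := biprod_zerol z o0.
have [P [sb]] := has_biprod b' z.
have [Q [sc]] := has_biprod z' z.
have r1 := real_sum sa sb sc pqd' (real_split so).
have sx : ext_sum sa sc d' (0 : EE C z o) = pull (pr1 sc) d'.
  by rewrite /ext_sum pull0 push0 addr0 saE push_id.
rewrite sx in r1.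
(* The second deflation is (1, -h), whose kernel is the graph of h. *)
have [bg [bg1 bg2]] := biprod_shear sc h.
have r2 := real_split bg; rewrite bg1 bg2 in r2.
have [e [k [l [h' [d2 [hk [fh [rgf [rkl [_ _]]]]]]]]]] := ET4op r1 r2.
rewrite -pull_comp compDr compA pr1in1 comp1m pr1in2 addr0 in rkl.
suff [t ut] : exists t : F w e, u = push l t by exists e, k, l, t.
set f := biprod_map _ _ _ _ in rgf fh.
have f2 : pr2 sc ∘ f = pr2 sb.
  rewrite /f /biprod_map soE compDr compm1 !compA pr2in1 pr2in2.
  by rewrite comp1m !comp0l add0r.
have f1 : pr1 sc ∘ f = q' ∘ pr1 sb.
  rewrite /f /biprod_map soE compDr compm1 !compA pr1in1 pr1in2.
  by rewrite comp1m comp0l addr0.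
have [|t tE] := exF _ _ _ _ _ _ rgf w (push (in1 sb) v + push (in2 sb) u).
  rewrite pushD -!push_comp !compDl !compNl -!(compA h) f1 f2.
  rewrite -!compA pr1in1 pr1in2 pr2in1 pr2in2 compm1 compm1 !comp0r subr0 sub0r.
  by rewrite -huE -[- h]scaleN1r pushZl scaleN1r subrr.
exists t; have := congr1 (push (pr2 sb)) tE.
rewrite pushD -!push_comp pr2in1 pr2in2 push0l push_id add0r => ->.
by rewrite -f2 -compA fh compA compDr compA pr2in1 comp0l add0r pr2in2 comp1m.
Qed.

(** A word, as a formal sum of x_i (x) e_i, lifts to d when every e_i is a
    pullback of d along some h_i; v is then the sum of the images of the x_i,
    so that the word represents v (x) d. *)
Fixpoint lifting (w z a : C) (d : EE C z a) (s : seq (symb F (EE C) w a))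
    (v : F w z) : Prop :=
  if s is t :: s' then
    exists (h : Hom (projT1 t) z) (u : F w z),
      [/\ (projT2 t).2 = pull h d, lifting d s' u
        & v = push h (projT2 t).1 + u]
  else v = 0.

Lemma lifting1 w z a m (h : Hom m z) (d : EE C z a) (x : F w m) e :
  e = pull h d -> lifting d [:: tens x e] (push h x).
Proof. by move=> eh; exists h, 0; rewrite addr0. Qed.

Lemma lifting_cat w z a (d : EE C z a) s s' (v v' : F w z) :
  lifting d s v -> lifting d s' v' -> lifting d (s ++ s') (v + v').
Proof.
move=> sv s'v'; elim: s v sv => [|t s IH] v /=.
  by move=> ->; rewrite add0r.
move=> [h [u [th su ->]]]; exists h, (u + v'); rewrite addrA.
by split=> //; exact: IH.
Qed.

Lemma push_lifting w z z' a (h : Hom z z') (d : EE C z a) (d' : EE C z' a) s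
    (v : F w z) :
  d = pull h d' -> lifting d s v -> lifting d' s (push h v).
Proof.
move=> dh; elim: s v => [|t s IH] v /=; first by move=> ->; rewrite push0.
move=> [k [u [tk su ->]]]; exists (h ∘ k), (push h u).
rewrite pushD push_comp pull_comp -dh; split=> //; exact: IH.
Qed.

Lemma lifting_unique w z a (d : EE C z a) s (v v' : F w z) :
  lifting d s v -> lifting d s v' -> in_defect d (v - v').
Proof.
elim: s v v' => [|t s IH] v v' /=.
  by move=> -> ->; rewrite subr0; exact: in_defect0.
move=> [h [u [th su ->]]] [h' [u' [th' su' ->]]].
rewrite opprD addrACA; apply: in_defectD; last exact: IH.
by apply: in_defect_lifts; rewrite -th.
Qed.

Lemma EE_join z z' a (d : EE C z a) (d' : EE C z' a) :
  exists (p : C) (i : Hom z p) (i' : Hom z' p) (e : EE C p a),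
    d = pull i e /\ d' = pull i' e.
Proof.
have [p [s]] := has_biprod z z'.
exists p, (in1 s), (in2 s), (pull (pr1 s) d + pull (pr2 s) d').
rewrite !pullD -!pull_comp pr1in1 pr2in2 pr1in2 pr2in1 !pull_id !pull0l.
by rewrite addr0 add0r.
Qed.

(** Directedness: finitely many classes in E(-, a) are pulled back from one. *)
Lemma lifting_exists w a (s : seq (symb F (EE C) w a)) :
  exists (z : C) (d : EE C z a) (v : F w z), lifting d s v.
Proof.
elim: s => [|[m [x e]] s [z [d [v sv]]]].
  by have [o _] := has_zero C; exists o, 0, 0.
have [p [i [i' [d' [ei di']]]]] := EE_join e d.
exists p, d', (push i x + push i' v), i, (push i' v).
by split=> //; exact: push_lifting sv.
Qed.

Lemma lifting_coend w z a (d : EE C z a) s (v : F w z) :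
  lifting d s v -> coend_eq s [:: tens v d].
Proof.
elim: s v => [|[m [x e]] s IH] v /=.
  by move=> ->; apply: ce_sym; exact: ce_zero.
move=> [h [u [-> su ->]]].
apply: (@ce_trans _ _ _ _ _ _ _ ([:: tens (push h x) d] ++ [:: tens u d])).
  rewrite -cat1s; apply: ce_cat; last exact: IH.
  by apply: ce_sym; exact: ce_balance.
by apply: ce_sym; exact: ce_addl.
Qed.

(** Sums of tensors collapse, by the existence of a common lift. *)
Lemma tensor_surj w a (xi : coend F (EE C) w a) :
  exists (z : C) (v : F w z) (d : EE C z a), xi = tensor v d.
Proof.
have [z [d [v sv]]] := lifting_exists (repr (xi : coend_obj F (EE C) w a)).
exists z, v, d; rewrite -[LHS]reprK; apply/coend_piP.
exact: lifting_coend sv.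
Qed.

(** Equality of two words in the colimit of the defect quotients. *)
Definition equal_lifts w a (s s' : seq (symb F (EE C) w a)) : Prop :=
  exists (z : C) (d : EE C z a) (v v' : F w z),
    [/\ lifting d s v, lifting d s' v' & in_defect d (v - v')].

(** The two lifts of the middle word to the joint class agree only modulo its
    defect, by [lifting_unique]. *)
Lemma equal_lifts_trans w a (s t u : seq (symb F (EE C) w a)) :
  equal_lifts s t -> equal_lifts t u -> equal_lifts s u.
Proof.
move=> [z [d [v [v' [sv tv' vv']]]]] [z1 [d1 [v1 [v1' [tv1 uv1' vv1']]]]].
have [p [i [i1 [e [de d1e]]]]] := EE_join d d1.
exists p, e, (push i v), (push i1 v1'); split.
- exact: push_lifting sv.
- exact: push_lifting uv1'.
rewrite -(subrKA (push i v')) -pushB.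
apply: in_defectD; first exact: push_in_defect vv'.
rewrite -(subrKA (push i1 v1)) -(pushB i1 v1).
apply: in_defectD; last exact: push_in_defect vv1'.
apply: lifting_unique; first exact: push_lifting tv'.
exact: push_lifting tv1.
Qed.

Lemma equal_lifts_refl w a (s : seq (symb F (EE C) w a)) : equal_lifts s s.
Proof.
have [z [d [v sv]]] := lifting_exists s.
by exists z, d, v, v; split=> //; rewrite subrr; exact: in_defect0.
Qed.

(** The colimit of the defect quotients satisfies the relations that define the
    coend. *)
Lemma coend_eq_lifts w a (s t : seq (symb F (EE C) w a)) :
  coend_eq s t -> equal_lifts s t.
Proof.
have same z (d : EE C z a) s' t' (v v' : F w z) : lifting d s' v ->
    lifting d t' v' -> v = v' -> equal_lifts s' t'.
  move=> sv tv vv'; exists z, d, v, v'; split=> //.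
  by rewrite vv' subrr; exact: in_defect0.
elim=> {s t} [s|s t _|s t u _ st _ tu|s s' t t' _ ss _ tt|s t|m y|m x x' y
  |m x y y'|m r x y|m m' h x y].
- exact: equal_lifts_refl.
- move=> [z [d [v [v' [sv tv vv']]]]]; exists z, d, v', v; split=> //.
  by rewrite -opprB; exact: in_defectN.
- exact: equal_lifts_trans st tu.
- have [z [d [v [v' [sv sv' vv']]]]] := ss.
  have [z1 [d1 [v1 [v1' [tv tv' vv1']]]]] := tt.
  have [p [i [i1 [e [de d1e]]]]] := EE_join d d1.
  exists p, e, (push i v + push i1 v1), (push i v' + push i1 v1'); split.
  + by apply: lifting_cat; [exact: push_lifting sv|exact: push_lifting tv].
  + by apply: lifting_cat; [exact: push_lifting sv'|exact: push_lifting tv'].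
  + rewrite opprD addrACA -!pushB.
    apply: in_defectD; first exact: push_in_defect vv'.
    exact: push_in_defect vv1'.
- have [z [d [v sv]]] := lifting_exists s.
  have [z1 [d1 [v1 tv]]] := lifting_exists t.
  have [p [i [i1 [e [de d1e]]]]] := EE_join d d1.
  have sv' := push_lifting de sv; have tv' := push_lifting d1e tv.
  apply: (same _ _ _ _ _ _ (lifting_cat sv' tv') (lifting_cat tv' sv')).
  by rewrite addrC.
- apply: (same _ y _ _ (push (idm m) 0) 0) => //; last by rewrite push0.
  by apply: lifting1; rewrite pull_id.
- apply: (same _ y _ _ (push (idm m) (x + x'))
    (push (idm m) x + push (idm m) x')); last by rewrite pushD.
    by apply: lifting1; rewrite pull_id.
  by rewrite -cat1s; apply: lifting_cat; apply: lifting1; rewrite pull_id.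
- have [p [i [i' [e [ye ye']]]]] := EE_join y y'.
  apply: (same _ e _ _ (push (i + i') x) (push i x + push i' x)).
  + by apply: lifting1; rewrite pullDl -ye -ye'.
  + by rewrite -cat1s; apply: lifting_cat; exact: lifting1.
  + by rewrite pushDl.
- apply: (same _ y _ _ (push (idm m) (r *: x)) (push (r *: idm m) x)).
  + by apply: lifting1; rewrite pull_id.
  + by apply: lifting1; rewrite pullZl pull_id.
  + by rewrite pushZl pushZ.
- apply: (same _ y _ _ (push (idm m') (push h x)) (push h x)).
  + by apply: lifting1; rewrite pull_id.
  + exact: lifting1.
  + by rewrite push_id.
Qed.

(** Exactness of F(w, b) -> F(w, z) -> (F (x) E)(w, a) in the middle. *)
Lemma tensor_eq0 w z a (v : F w z) (d : EE C z a) :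
  half_exact F -> tensor v d = 0 -> in_defect d v.
Proof.
move=> exF /coend_piP/coend_eq_lifts[p [e [u [u' [lu u'0 uu']]]]].
move: lu => [h [u1 [dh u10 uE]]].
rewrite /= in u10 u'0 uE dh.
by move: uu'; rewrite u'0 uE u10 addr0 subr0 dh; exact: in_defect_reflect.
Qed.

(** An element u (x) th killed by push y can be rewritten, by [tensor_eq0], so
    that its second factor is killed by push y; half exactness of E applies to
    that factor. *)
Lemma coend_half_exact : half_exact F -> half_exact (coend F (EE C)).
Proof.
move=> exF a b c x y d xyd w xi.
have [m [u [th ->]]] := tensor_surj xi.
rewrite push_tensor => /(tensor_eq0 exF)[b' [p [q [t [pqd ->]]]]].
rewrite tensor_balance.
have [|e' ->] := EE_half_exact xyd (e := pull q th).
  by rewrite push_pull (pull_deflation pqd).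
by exists (tensor t e'); rewrite push_tensor.
Qed.

End InDefect.
End Defect.

(** * Higher extensions *)

Section ExtExact.
Variables (R : comPzRingType) (C : extriCat R).

Lemma Ext_half_exact i : half_exact (Ext C i).
Proof.
rewrite /Ext; elim: i.-1 => [|k IH]; first exact: EE_half_exact.
exact: coend_half_exact.
Qed.

(** Cancellation of the last factor of a Yoneda product. *)
Lemma tensor_defl_eq0 i (w a b c : C) (x : Hom a b) (y : Hom b c) (d : EE C c a)
    (e : Ext C i w c) :
  real x y d -> (forall t : Ext C i w b, t = 0) -> tensor e d = 0 -> e = 0.
Proof.
move=> xyd tb0 /(tensor_eq0 (@Ext_half_exact i))/(in_defect_real xyd)[t ->].
by rewrite (tb0 t) push0.
Qed.

End ExtExact.

Section Vanishing.
Variables (R : comPzRingType) (C : addCat R) (X : addSub C) (F : bimod C).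

Lemma factors_pull0 (w a : C) : factors X (idm w) ->
  (forall m : C, X m -> forall e : F m a, e = 0) -> forall e : F w a, e = 0.
Proof.
move=> [m [u [v [Xm uv]]]] F0 e.
by rewrite -[e]pull_id uv pull_comp (F0 m Xm (pull v e)) pull0.
Qed.

Lemma factors_push0 (w a : C) : factors X (idm a) ->
  (forall m : C, X m -> forall e : F w m, e = 0) -> forall e : F w a, e = 0.
Proof.
move=> [m [u [v [Xm uv]]]] F0 e.
by rewrite -[e]push_id uv push_comp (F0 m Xm (push u e)) push0.
Qed.

Lemma mem_factors (a : C) : X a -> factors X (idm a).
Proof. by exists a, (idm a), (idm a); rewrite comp1m. Qed.

(** This does not put a in X: a retract of an object of X need not be a direct
    summand of it. *)
Lemma iso_zero_quot (a : C) :
  iso_zero (quot_functor X a) <-> factors X (idm a).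
Proof.
split=> [[z [[z1 _] [f [g [gf _]]]]]|fa].
  have f0 : f = 0 by exact: z1.
  move: gf; rewrite f0 comp0r => /esym /qhom_piP.
  by rewrite subr0.
have ida : idm (quot_functor X a) = 0.
  by apply/qhom_piP; rewrite subr0.
exists (quot_functor X a); split.
  split=> b f g; [rewrite -[f]comp1m -[g]comp1m|
    rewrite -[f]compm1 -[g]compm1]; by rewrite ida ?comp0l ?comp0r.
by exists (idm _), (idm _); rewrite comp1m.
Qed.

End Vanishing.

(** * Towers of approximations *)

Section Towers.
Variables (R : comPzRingType) (C : extriCat R) (X : addSub C).

(** A zero class is also realised by a -> a + c -> c, so b is isomorphic to
    a + c; unlike its retracts, the direct summands of b stay in X. *)
Lemma split_mem (a b c : C) (x : Hom a b) (y : Hom b c) :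
  real x y (0 : EE C c a) -> X b -> X a /\ X c.
Proof.
move=> xy0 Xb; have [p [s]] := has_biprod a c.
have [f [fiso _]] := (realP (in1 s) (pr2 s) xy0).1 (real_split s).
by apply: (sub_summand s); apply: sub_iso Xb; exists f.
Qed.

Lemma rigidW n : rigid X n.+1 -> rigid X n.
Proof. by move=> rX i /andP[i1 /leqW i2]; apply: rX; rewrite i1. Qed.

Section Cosyzygy.
Variable T : forall a : C, left_tri X a.

(** The recursion goes through the first triangle, not the last, so that the
    last factor of [cosyz_class] is the class of the triangle of a. *)
Fixpoint cosyz (n : nat) (a : C) : C :=
  if n is n'.+1 then cosyz n' (lt_plus (T a)) else a.

Lemma Tr_plusP n a : Tr_plus T n a <-> factors X (idm (cosyz n a)).
Proof.
rewrite -iso_zero_quot /Tr_plus /mkset.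
have -> : cosyz n a = iter n (fun b => lt_plus (T b)) a.
  by elim: n a => //= n IH a; rewrite IH -iterSr.
have -> // : pow_functor (suspension T) n (quot_functor X a)
  = iter n (fun b => lt_plus (T b)) a.
by elim: n => //= n ->.
Qed.

Lemma cosyz_factors n a : factors X (idm a) -> factors X (idm (cosyz n a)).
Proof.
elim: n a => //= n IH a fa; apply: IH; rewrite -[idm _]subr0.
apply: (@lt_mor_factors _ _ _ T _ _ (idm a) 0 (idm _) 0); last by rewrite subr0.
  by split; rewrite ?comp1m ?compm1 ?push_id ?pull_id.
by split; rewrite ?comp0l ?comp0r ?push0l ?pull0l.
Qed.

(** The Yoneda product of the classes of the first n + 1 triangles. *)
Fixpoint cosyz_class (n : nat) (a : C) : Ext C n.+1 (cosyz n.+1 a) a :=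
  if n is n'.+1 return Ext C n.+1 (cosyz n.+1 a) a
  then tensor (cosyz_class n' (lt_plus (T a))) (lt_d (T a)) else lt_d (T a).

(** Cancelling the factors from the right leaves the class of the triangle
    that starts at [cosyz n a]. *)
Lemma cosyz_class0 n a : rigid X n -> factors X (idm (cosyz n.+1 a)) ->
  cosyz_class n a = 0 -> X (cosyz n a).
Proof.
elim: n a => [|n IH] a rX fa.
  move=> /= da0; have := lt_real (T a); rewrite da0 => /split_mem.
  by case=> //; have [] := lt_approx (T a).
move=> e0; apply: (IH _ (rigidW rX) fa).
apply: (tensor_defl_eq0 (i := n.+1) (lt_real (T a))) e0.
apply: (factors_pull0 fa) => m Xm.
by apply: rX => //; rewrite ?leqnn //; have [] := lt_approx (T a).
Qed.

(** [cosyz_class0] moves the object at level n into X; its identity then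
    factors through X, and the descent along the tower continues. *)
Lemma cosyz_mem n a : rigid X n.+1 ->
  (forall i, (1 <= i <= n.+1)%N -> rperp X i a) ->
  factors X (idm (cosyz n.+1 a)) -> X a.
Proof.
elim: n => [|n IH] rX aX fa.
  apply: (cosyz_class0 (n := 0)) => //; first exact: rigidW rX.
  by apply: (factors_pull0 fa); exact: (aX 1).
apply: (IH (rigidW rX)).
  by move=> i /andP[i1 /leqW i2]; apply: aX; apply/andP.
apply/mem_factors/cosyz_class0 => //; first exact: rigidW rX.
by apply: (factors_pull0 fa); apply: (aX n.+2); rewrite leqnn.
Qed.

End Cosyzygy.

Section Syzygy.
Variable T : forall a : C, right_tri X a.

Definition syz (n : nat) (a : C) : C := iter n (fun b => rt_minus (T b)) a.

Lemma Tr_minusP n a : Tr_minus T n a <-> factors X (idm (syz n a)).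
Proof.
rewrite -iso_zero_quot /Tr_minus /mkset.
have -> // : pow_functor (loop T) n (quot_functor X a) = syz n a.
by elim: n => //= n ->.
Qed.

Lemma syz_factors n a : factors X (idm a) -> factors X (idm (syz n a)).
Proof.
move=> fa; elim: n => //= n IH; rewrite -[idm _]subr0.
apply: (@rt_mor_factors _ _ _ T _ _ (idm (syz n a)) 0 (idm _) 0);
  last by rewrite subr0.
  by split; rewrite ?comp1m ?compm1 ?push_id ?pull_id.
by split; rewrite ?comp0l ?comp0r ?push0l ?pull0l.
Qed.

Fixpoint syz_class (n : nat) (a : C) : Ext C n.+1 a (syz n.+1 a) :=
  if n is n'.+1 return Ext C n.+1 a (syz n.+1 a)
  then tensor (syz_class n' a) (rt_d (T (syz n'.+1 a))) else rt_d (T a).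

(** Here the cancellation from the right ends at the class of the triangle
    of a. *)
Lemma syz_class0 n a : (forall i, (1 <= i <= n)%N -> lperp X i a) ->
  syz_class n a = 0 -> X a.
Proof.
elim: n => [|n IH] aX.
  move=> /= da0; have := rt_real (T a); rewrite da0 => /split_mem.
  by case=> //; have [] := rt_approx (T a).
move=> e0; apply: IH => [i /andP[i1 i2]|].
  by apply: aX; rewrite i1 leqW.
apply: (tensor_defl_eq0 (i := n.+1) (rt_real (T (syz n.+1 a)))) e0.
by apply: aX; [rewrite leqnn|have [] := rt_approx (T (syz n.+1 a))].
Qed.

End Syzygy.
End Towers.

Local Open Scope classical_set_scope.

Theorem theorem1p1 (R : comPzRingType) (n : nat) (hn : (1 <= n)%N)
    (C : extriCat R) (X : addSub C) (hX : rigid X n) :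
  (strongly_cov_finite X -> forall T : forall a : C, left_tri X a,
     [set a | X a] =
     Tr_plus T n `&` \bigcap_(i in [set i | (1 <= i <= n)%N]) rperp X i) /\
  (strongly_contrav_finite X -> forall T : forall a : C, right_tri X a,
     [set a | X a] =
     Tr_minus T n `&` \bigcap_(i in [set i | (1 <= i <= n)%N]) lperp X i).
Proof.
case: n hn hX => // n _ rX; split=> _ T; apply/seteqP; split=> a /=.
- move=> Xa; split; last by move=> i iP b Xb; exact: rX.
  by apply/Tr_plusP/cosyz_factors/mem_factors.
- move=> [/Tr_plusP fa aX].
  exact: cosyz_mem rX aX fa.
- move=> Xa; split; last by move=> i iP b Xb; exact: rX.
  by apply/Tr_minusP/syz_factors/mem_factors.
- move=> [/Tr_minusP fa aX].
  apply: (@syz_class0 _ _ _ T n).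
    by move=> i /andP[i1 i2]; apply: aX; rewrite /= i1 leqW.
  by apply: (factors_push0 fa); apply: (aX n.+1); rewrite /= leqnn.
Qed.
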